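(* Let $\mathbf{n}\in\mathfrak{gl}_n(\mathbb{R})$ be a nilpotent matrix with nilpotency index $p\ge 2$ and let $\mathbf{m}$ be its conjugate transpose (in the sense defined in the context). Define linear operators on $\mathcal{P}^n$ by $$\bar{\mathbf{n}}_\star:=\mathbf{n}_\star,\qquad \bar{\mathbf{m}}_\star:=\sum_{i=1}^{p-1}\sum_{l=0}^{i-1}(\mathbf{n}_\star)^{l}(\mathbf{m}_\star)^{i}(\mathbf{n}_\star)^{i-l-1},\qquad \bar{\mathbf{h}}_\star:=\sum_{i=1}^{p-1}\left[(\mathbf{m}_\star)^{i},(\mathbf{n}_\star)^{i}\right].$$ Then these operators form an $\mathfrak{sl}_2$-triple, i.e. $$[\bar{\mathbf{m}}_\star,\bar{\mathbf{n}}_\star]=\bar{\mathbf{h}}_\star,\qquad [\bar{\mathbf{h}}_\star,\bar{\mathbf{n}}_\star]=-2\bar{\mathbf{n}}_\star,\qquad [\bar{\mathbf{h}}_\star,\bar{\mathbf{m}}_\star]=2\bar{\mathbf{m}}_\star.$$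
   Context: $P_k$ is the space of real homogeneous polynomials of degree $k$ in $x_1,\dots,x_n$; $\mathcal{P}^n_k=P_{k+1}\otimes\mathbb{R}^n$ for $k\ge 0$, and $\mathcal{P}^n=\prod_{k\ge 0}\mathcal{P}^n_k$ (formal vector-valued maps $\varphi$ with $\varphi(0)=0$). For $A\in\mathfrak{gl}_n(\mathbb{R})$, the operator $A_\star:\mathcal{P}^n\to\mathcal{P}^n$ is $(A_\star\varphi)(x)=\varphi(Ax)$. Note that $\bar{\mathbf{m}}_\star$ and $\bar{\mathbf{h}}_\star$ are the operators defined by the displayed formulas, not the substitution operators of a matrix $\bar{\mathbf{m}}$ or $\bar{\mathbf{h}}$. $[X,Y]=XY-YX$ and $X^0$ is the identity. The nilpotency index of $\mathbf{n}$ is the least $p$ with $\mathbf{n}^p=0$. Conjugate transpose: let $\mathsf{N}$ be the (upper triangular) Jordan normal form of $\mathbf{n}$, let $P\in GL_n(\mathbb{R})$ satisfy $\mathbf{n}=P^{-1}\mathsf{N}P$, and let $\mathsf{M}=\mathsf{N}^t$; then $\mathbf{m}:=P^{-1}\mathsf{M}P$. *)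

(* Defs.v *)
From HB Require Import structures.
From mathcomp Require Import all_boot all_order all_algebra.
From mathcomp Require Import boolp reals.
From mathcomp Require Import mpoly.

Set Implicit Arguments.
Unset Strict Implicit.
Unset Printing Implicit Defensive.

Import GRing.Theory.
Local Open Scope ring_scope.

(* {linear V -> V} carries no ring structure in the library; the product
   below is composition, x * y = x \o y.                                      *)
Section Endo.
Context (K : pzRingType) (V : lmodType K).

Definition endo := {linear V -> V}.

Lemma endoP (f g : endo) : f =1 g -> f = g.
Proof.
case: f g => [f [[af] [lf]]] [g [[ag] [lg]]] /= /funext fg.
move: fg af lf ag lg => -> af lf ag lg.
by rewrite (Prop_irrelevance af ag) (Prop_irrelevance lf lg).
Qed.

Definition endo0 : endo := \0.
Definition endoN (f : endo) : endo := \- f.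
Definition endoD (f g : endo) : endo := f \+ g.
Definition endo1 : endo := idfun.
Definition endoM (f g : endo) : endo := f \o g.

HB.instance Definition _ := gen_eqMixin endo.
HB.instance Definition _ := gen_choiceMixin endo.

Fact endoDA : associative endoD.
Proof. by move=> f g h; apply: endoP => x /=; rewrite addrA. Qed.
Fact endoDC : commutative endoD.
Proof. by move=> f g; apply: endoP => x /=; rewrite addrC. Qed.
Fact endo0D : left_id endo0 endoD.
Proof. by move=> f; apply: endoP => x /=; rewrite add0r. Qed.
Fact endoND : left_inverse endo0 endoN endoD.
Proof. by move=> f; apply: endoP => x /=; rewrite addNr. Qed.

HB.instance Definition _ :=
  GRing.isZmodule.Build endo endoDA endoDC endo0D endoND.

Fact endoMA : associative endoM.
Proof. by move=> f g h; apply: endoP. Qed.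
Fact endo1M : left_id endo1 endoM.
Proof. by move=> f; apply: endoP. Qed.
Fact endoM1 : right_id endo1 endoM.
Proof. by move=> f; apply: endoP. Qed.
Fact endoMDl : left_distributive endoM +%R.
Proof. by move=> f g h; apply: endoP. Qed.
Fact endoMDr : right_distributive endoM +%R.
Proof. by move=> f g h; apply: endoP => x /=; rewrite linearD. Qed.

HB.instance Definition _ :=
  GRing.Zmodule_isPzRing.Build endo endoMA endo1M endoM1 endoMDl endoMDr.

End Endo.

Definition commutator (A : pzRingType) (x y : A) : A := x * y - y * x.

(* P_{k+1} (x) R^n is represented by n-tuples of homogeneous polynomials of
   degree k+1, and the formal maps by sequences of their graded components.   *)
Section FormalMaps.
Context (K : comNzRingType) (n : nat).

Definition formal_map := forall k : nat, {ffun 'I_n -> dhomog n K k.+1}.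

HB.instance Definition _ := gen_eqMixin formal_map.
HB.instance Definition _ := gen_choiceMixin formal_map.

Implicit Types f g h : formal_map.

Definition fmap0 : formal_map := fun _ => 0.
Definition fmapN f : formal_map := fun k => - f k.
Definition fmapD f g : formal_map := fun k => f k + g k.
Definition fmapZ (c : K) f : formal_map := fun k => c *: f k.

Fact fmapDA : associative fmapD.
Proof. by move=> f g h; apply: functional_extensionality_dep => k; apply: addrA. Qed.
Fact fmapDC : commutative fmapD.
Proof. by move=> f g; apply: functional_extensionality_dep => k; apply: addrC. Qed.
Fact fmap0D : left_id fmap0 fmapD.
Proof. by move=> f; apply: functional_extensionality_dep => k; apply: add0r. Qed.
Fact fmapND : left_inverse fmap0 fmapN fmapD.
Proof. by move=> f; apply: functional_extensionality_dep => k; apply: addNr. Qed.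

HB.instance Definition _ :=
  GRing.isZmodule.Build formal_map fmapDA fmapDC fmap0D fmapND.

Fact fmapZA a b f : fmapZ a (fmapZ b f) = fmapZ (a * b) f.
Proof. by apply: functional_extensionality_dep => k; apply: scalerA. Qed.
Fact fmap1Z : left_id 1 fmapZ.
Proof. by move=> f; apply: functional_extensionality_dep => k; apply: scale1r. Qed.
Fact fmapZDr : right_distributive fmapZ +%R.
Proof. by move=> a f g; apply: functional_extensionality_dep => k; apply: scalerDr. Qed.
Fact fmapZDl f : {morph fmapZ^~ f : a b / a + b}.
Proof. by move=> a b; apply: functional_extensionality_dep => k; apply: scalerDl. Qed.

HB.instance Definition _ :=
  GRing.Zmodule_isLmodule.Build K formal_map fmapZA fmap1Z fmapZDr fmapZDl.

(* The i-th coordinate of x |-> A x, as a linear form in x_1, ..., x_n.       *)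
Definition linear_forms (A : 'M[K]_n) : n.-tuple {mpoly K[n]} :=
  [tuple \sum_j A i j *: 'X_j | i < n].

Lemma homog_subst (A : 'M[K]_n) d (p : {mpoly K[n]}) :
  p \is d.-homog -> p \mPo linear_forms A \is d.-homog.
Proof.
move=> /dhomogP hp; rewrite comp_mpolyEX big_seq; apply: rpred_sum => m /hp.
rewrite /= mdegE => <-; apply: dhomogZ; rewrite comp_mpolyX.
apply: (big_rec2 (fun d (q : {mpoly K[n]}) => q \is d.-homog)).
  exact: dhomog1.
move=> i e q _ hq; apply: dhomogM => //.
rewrite -[X in X.-homog]mul1n; apply: dhomogMn; rewrite tnth_mktuple.
by apply: rpred_sum => j _; apply: dhomogZ; rewrite dhomogX /= mdeg1.
Qed.

Definition subst_homog (A : 'M[K]_n) d (p : dhomog n K d) : dhomog n K d :=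
  DHomog (homog_subst A (dhomog_is_dhomog p)).

(* (A_* f)(x) = f (A x) *)
Definition subst_map (A : 'M[K]_n) f : formal_map :=
  fun k => [ffun i => subst_homog A (f k i)].

Fact subst_map_is_linear A : linear (subst_map A).
Proof.
move=> c f g; apply: functional_extensionality_dep => k; apply/ffunP => i.
by apply/val_inj; rewrite !ffunE /= comp_mpolyD comp_mpolyZ.
Qed.

HB.instance Definition _ A := GRing.isLinear.Build K formal_map formal_map _
  (subst_map A) (subst_map_is_linear A).

Definition star (A : 'M[K]_n) : endo formal_map := subst_map A.

Definition nbar_star (N : 'M[K]_n) : endo formal_map := star N.

Definition mbar_star (N M : 'M[K]_n) (p : nat) : endo formal_map :=
  \sum_(1 <= i < p) \sum_(0 <= l < i)
    star N ^+ l * star M ^+ i * star N ^+ (i - l - 1).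

Definition hbar_star (N M : 'M[K]_n) (p : nat) : endo formal_map :=
  \sum_(1 <= i < p) commutator (star M ^+ i) (star N ^+ i).

End FormalMaps.

Section Jordan.
Context (K : fieldType).

Definition jordan_block (a : K) (s : nat) : 'M[K]_s :=
  \matrix_(i, j) (if i == j then a else (i.+1 == j :> nat)%:R).

Definition jordan_form n (J : 'M[K]_n) : Prop :=
  exists (b : nat) (s : 'I_b -> nat) (a : 'I_b -> K)
         (e : (\sum_(i < b) s i)%N = n),
    (forall i, (0 < s i)%N) /\
    J = castmx (e, e) (\mxdiag_(i < b) jordan_block (a i) (s i)).

(* The Jordan form is unique only up to the order of its blocks and the
   conjugating matrix is not unique, hence a relation between N and M.        *)
Definition conjugate_transpose n (N M : 'M[K]_n) : Prop :=
  exists J P : 'M[K]_n,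
    [/\ jordan_form J, P \in unitmx,
        N = invmx P *m J *m P & M = invmx P *m J^T *m P].

Definition nilpotency_index n (N : 'M[K]_n) (p : nat) : Prop :=
  N ^+ p = 0 /\ forall q, N ^+ q = 0 -> (p <= q)%N.

End Jordan.

(* Main.v *)
(* The operators x = N_* and y = M_* satisfy the relations of a truncated shift
   and its transpose: x y x = x, y x y = y, and the idempotents e_i = x^i y^i and
   f_i = y^i x^i commute.  Here A |-> A_* reverses products, and 0_* = 0 because
   formal maps vanish at the origin.  Hence x e_i = e_{i+1} x and
   f_i x = x f_{i+1}, so that [h, x] telescopes to -2x; exchanging x and y gives
   [h, y] = 2y.  Each summand x^l y^i x^(i-l-1) of m thus has weight
   -2l + 2i - 2(i-l-1) = 2 under ad h, and [m, x] = h is a telescoping sum.     *)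
Require Import Defs.
From HB Require Import structures.
From mathcomp Require Import all_boot all_order all_algebra.
From mathcomp Require Import boolp reals.
From mathcomp Require Import mpoly.
From mathcomp Require Import zify.

Set Implicit Arguments.
Unset Strict Implicit.
Unset Printing Implicit Defensive.

Import GRing.Theory.
Local Open Scope ring_scope.

(** * Integer weights for the adjoint action of an element *)

Section Commutator.
Context (A : pzRingType).
Implicit Types (x y z h : A) (c : int).

Lemma commutator_suml (I : Type) (r : seq I) (P : pred I) (F : I -> A) x :
  commutator (\sum_(i <- r | P i) F i) x = \sum_(i <- r | P i) commutator (F i) x.
Proof. by rewrite /commutator mulr_suml mulr_sumr -sumrB. Qed.

Lemma commutatorNl x y : commutator (- x) y = - commutator x y.
Proof. by rewrite /commutator mulNr mulrN opprB addrC opprK. Qed.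

Definition has_weight h c x := commutator h x = x *~ c.

(** Since ad h is a derivation, weights add under products. *)
Lemma has_weightM h c d x y :
  has_weight h c x -> has_weight h d y -> has_weight h (c + d) (x * y).
Proof.
rewrite /has_weight /commutator => hx hy.
rewrite -[h * _](subrK (x * h * y)) mulrA -mulrBl hx -addrA -!mulrA -mulrBr hy.
by rewrite mulrzAl mulrzAr mulrzDr.
Qed.

Lemma has_weightX h c x n : has_weight h c x -> has_weight h (c * n%:Z) (x ^+ n).
Proof.
move=> hx; elim: n => [|n IHn].
  by rewrite /has_weight /commutator expr0 mulr1 mul1r subrr mulr0.
by rewrite exprS intS mulrDr mulr1; apply: has_weightM.
Qed.

Lemma has_weight_sum h c (I : eqType) (r : seq I) (P : pred I) (F : I -> A) :
    (forall i, i \in r -> P i -> has_weight h c (F i)) ->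
  has_weight h c (\sum_(i <- r | P i) F i).
Proof.
move=> hF; rewrite /has_weight /commutator mulr_sumr mulr_suml -sumrB.
rewrite -mulrzr mulr_suml big_seq_cond [RHS]big_seq_cond.
by apply: eq_bigr => i /andP[ri Pi]; rewrite mulrzr -(hF i ri Pi).
Qed.

End Commutator.

(** * The sl_2 relations in an abstract ring *)

Section TruncatedShift.
Context (A : pzRingType).
Implicit Types (x y : A) (p i : nat).

(* These relations hold in the monogenic inverse monoid truncated at
   [x ^+ p = 0], and are symmetric in [x] and [y]. *)
Record truncated_shift x y p : Prop := TruncatedShift {
  shift_xyx : x * y * x = x;
  shift_yxy : y * x * y = y;
  shift_comm_xy : forall i, GRing.comm (x * y) (y ^+ i * x ^+ i);
  shift_comm_yx : forall i, GRing.comm (y * x) (x ^+ i * y ^+ i);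
  shift_xyp : x ^+ p * y ^+ p = 0;
  shift_yxp : y ^+ p * x ^+ p = 0 }.

Lemma truncated_shift_sym x y p : truncated_shift x y p -> truncated_shift y x p.
Proof. by case. Qed.

Definition sl2_h x y p := \sum_(1 <= i < p) commutator (y ^+ i) (x ^+ i).

Definition sl2_m x y p :=
  \sum_(1 <= i < p) \sum_(0 <= l < i) x ^+ l * y ^+ i * x ^+ (i - l - 1).

Lemma sl2_h_sym x y p : sl2_h y x p = - sl2_h x y p.
Proof.
by rewrite /sl2_h -sumrN; apply: eq_bigr => i _; rewrite /commutator opprB.
Qed.

(** With u_l = x^l y^i x^(i-l), the l-th summand contributes u_l - u_(l+1), so for fixed i only u_0
    - u_i = y^i x^i - x^i y^i remains. *)
Lemma commutator_mn x y p : commutator (sl2_m x y p) x = sl2_h x y p.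
Proof.
rewrite commutator_suml; apply: eq_bigr => i _; rewrite commutator_suml.
rewrite [LHS](eq_big_nat _ _ (F2 := fun l =>
  - (x ^+ l.+1 * y ^+ i * x ^+ (i - l.+1) - x ^+ l * y ^+ i * x ^+ (i - l)))).
  rewrite sumrN telescope_sumr // subnn subn0 !expr0 mulr1 mul1r opprB.
  by rewrite /commutator.
move=> l /andP[_ lti]; rewrite /commutator opprB exprS -subnDA addn1.
by rewrite -(subnSK lti) exprSr !mulrA.
Qed.

Section Relations.
Context (x y : A) (p : nat) (xy : truncated_shift x y p).

(** On the right, the final y x commutes past x^i y^i and is absorbed by x y x = x. *)
Lemma shift_mulx_xy i : x * (x ^+ i * y ^+ i) = x ^+ i.+1 * y ^+ i.+1 * x.
Proof.
rewrite exprS [y ^+ i.+1]exprSr -!mulrA (mulrA (x ^+ i)) -(shift_comm_yx xy i).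
by rewrite !mulrA (shift_xyx xy).
Qed.

Lemma shift_yx_mulx i : y ^+ i * x ^+ i * x = x * (y ^+ i.+1 * x ^+ i.+1).
Proof.
rewrite exprS [x ^+ i.+1]exprSr !mulrA -(mulrA (x * y)) (shift_comm_xy xy i).
by rewrite -!mulrA [x * (y * x)]mulrA (shift_xyx xy).
Qed.

Lemma has_weight_hn : has_weight (sl2_h x y p) (- 2) x.
Proof.
(* For [p = 0] the relation x^p y^p = 0 reads 1 = 0, and the ring is trivial. *)
rewrite /has_weight; case: (posnP p) => [p0|p_gt0].
  have x0 : x = 0.
    have := shift_xyp xy; rewrite p0 !expr0 mulr1 => one0.
    by rewrite -[x]mul1r one0 mul0r.
  by rewrite x0 mul0rz /commutator mulr0 mul0r subrr.
(* The exchange rules turn the i-th term into [g i.+1 - g i]; the ends are [g p = 0] and [g 1],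
   which is twice [x]. *)
pose g i := x * (y ^+ i * x ^+ i) + x ^+ i * y ^+ i * x.
rewrite commutator_suml (eq_bigr (fun i => g i.+1 - g i)) => [|i _].
  rewrite telescope_sumr // /g (shift_xyp xy) (shift_yxp xy) mulr0 mul0r.
  by rewrite !expr1 mulrA (shift_xyx xy) addr0 sub0r mulrNz.
rewrite /commutator /g -shift_yx_mulx -shift_mulx_xy mulrBl mulrBr.
by rewrite opprB addrACA -opprD [X in - X]addrC.
Qed.

End Relations.

Lemma has_weight_hm x y p :
  truncated_shift x y p -> has_weight (sl2_h x y p) 2 (sl2_m x y p).
Proof.
move=> xy; have hx := has_weight_hn xy.
(* Exchanging [x] and [y] negates h, hence the opposite weight. *)
have hy : has_weight (sl2_h x y p) 2 y.
  have := has_weight_hn (truncated_shift_sym xy).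
  rewrite sl2_h_sym /has_weight commutatorNl mulrNz.
  exact: oppr_inj.
apply: has_weight_sum => i _ _; apply: has_weight_sum => l.
rewrite mem_index_iota => /andP[_ lti] _.
have := has_weightM (has_weightM (has_weightX l hx) (has_weightX i hy))
  (has_weightX (i - l - 1) hx).
(* Thanks to [l < i] the truncated difference [i - l - 1] is exact. *)
by congr (has_weight _ _ _); lia.
Qed.

End TruncatedShift.

(** * From matrices to substitution operators *)

Section Star.
Context (K : comNzRingType) (n : nat).
Implicit Types (A B : 'M[K]_n).

(** Substitution is a ring morphism, so it suffices to treat a single variable, where exchanging two
    sums yields the entries of B A. *)
Lemma comp_linear_forms A B (q : {mpoly K[n]}) :
  (q \mPo linear_forms B) \mPo linear_forms A = q \mPo linear_forms (B * A).
Proof.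
rewrite (comp_mpolyEX q (linear_forms B)) (comp_mpolyEX q (linear_forms _)).
rewrite raddf_sum; apply: eq_bigr => m _ /=.
rewrite comp_mpolyZ !comp_mpolyX rmorph_prod; congr (_ *: _).
apply: eq_bigr => i _; rewrite rmorphXn; congr (_ ^+ _).
rewrite !tnth_mktuple raddf_sum /=.
under eq_bigr => j _ do
  rewrite comp_mpolyZ comp_mpolyXU -tnth_nth tnth_mktuple scaler_sumr.
rewrite exchange_big; apply: eq_bigr => k _.
by rewrite mxE scaler_suml; apply: eq_bigr => j _; rewrite scalerA.
Qed.

Lemma star_mul A B : star A * star B = star (B * A).
Proof.
apply: endoP => f; apply: functional_extensionality_dep => k.
apply/ffunP => i; apply/val_inj; rewrite /= /star /= /subst_map !ffunE /=.
exact: comp_linear_forms.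
Qed.

Lemma star1 : star (1 : 'M[K]_n) = 1.
Proof.
apply: endoP => f; apply: functional_extensionality_dep => k.
apply/ffunP => i; apply/val_inj; rewrite /= /star /= /subst_map !ffunE /=.
rewrite -[RHS]comp_mpoly_id; congr (_ \mPo _); apply: eq_from_tnth => j.
rewrite !tnth_mktuple (bigD1 j) //= big1 => [|l lj].
  by rewrite mxE eqxx scale1r addr0.
by rewrite mxE eq_sym (negPf lj) scale0r.
Qed.

(* Formal maps have no constant term. *)
Lemma star0 : star (0 : 'M[K]_n) = 0.
Proof.
apply: endoP => f; apply: functional_extensionality_dep => k.
apply/ffunP => i; apply/val_inj; rewrite /= /star /= /subst_map !ffunE /=.
rewrite comp_mpolyE big_seq big1 // => m fm.
have /dhomogP/(_ _ fm) /= mk := dhomog_is_dhomog (f k i).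
(* The degree k+1 is positive, so some variable occurs in [m], and its image 0 kills the
   monomial. *)
have [j mj] : exists j, m j != 0%N.
  apply/existsP; apply: contra_eqT mk => /existsPn m0.
  by rewrite mdegE big1 // => j _; apply/eqP/negPn/m0.
rewrite (bigD1 j) //= tnth_mktuple big1 => [|l _].
  by rewrite expr0n (negPf mj) mul0r scaler0.
by rewrite mxE scale0r.
Qed.

Lemma star_exp A i : star A ^+ i = star (A ^+ i).
Proof.
by elim: i => [|i IHi]; rewrite ?star1 // exprSr IHi star_mul exprS.
Qed.

(** Reversing products preserves the palindromic relations, and swaps the two commutation relations
    and the two vanishing ones. *)
Lemma truncated_shift_star A B p :
  truncated_shift A B p -> truncated_shift (star A) (star B) p.
Proof.
case=> aba bab ab ba zab zba.
split=> [||i|i||]; rewrite /GRing.comm ?star_exp !star_mul.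
- by rewrite mulrA aba.
- by rewrite mulrA bab.
- by rewrite -ba.
- by rewrite -ab.
- by rewrite zba star0.
- by rewrite zab star0.
Qed.

End Star.

(** * Shift matrices and their transposes *)

Section ShiftMatrix.
Context (K : comNzRingType) (n : nat).
Implicit Types (A B J : 'M[K]_n).

(** The pair encodes the integer offset j - i = r - s without subtraction; offsets add under
    products. *)
Definition on_diagonal A (r s : nat) :=
  forall i j : 'I_n, A i j != 0 -> (i + r = j + s)%N.

Lemma on_diagonalM A B r s r' s' :
  on_diagonal A r s -> on_diagonal B r' s' -> on_diagonal (A * B) (r + r') (s + s').
Proof.
move=> hA hB i j; apply: contraNeq => ij; rewrite mxE big1 // => k _.
have [->|/hA Aik] := eqVneq (A i k) 0; first by rewrite mul0r.
have [->|/hB Bkj] := eqVneq (B k j) 0; first by rewrite mulr0.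
by case/negP: ij; apply/eqP; lia.
Qed.

Lemma on_diagonalX A r s i : on_diagonal A r s -> on_diagonal (A ^+ i) (r * i) (s * i).
Proof.
move=> hA; elim: i => [|i IHi].
  move=> j k; rewrite !muln0 !addn0 mxE.
  by have [->|] := eqVneq j k => //; rewrite eqxx.
by rewrite exprS !mulnS; apply: on_diagonalM.
Qed.

Lemma on_diagonal_comm A B r s :
  on_diagonal A r r -> on_diagonal B s s -> GRing.comm A B.
Proof.
have diag C k : on_diagonal C k k -> exists d, C = diag_mx d.
  by move=> hC; apply/diag_mxP/is_diag_mxP => i j; apply: contraNeq => /hC/addIn ->.
by move=> /diag[d ->] /diag[e ->]; apply: diag_mxC.
Qed.

Definition shift_matrix J := forall i j, J i j != 0 -> J i j = 1 /\ j = i.+1 :> nat.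

(** Each row and column has at most one nonzero entry, equal to 1, so the double sum for the entry
    (i, j) reduces to the cube of [J i j]. *)
Lemma shift_matrix_partial_isometry J : shift_matrix J -> J * J^T * J = J.
Proof.
move=> hJ; apply/matrixP => i j; rewrite -mulrA mxE.
have ev k l : J k l = (J k l != 0)%:R.
  by have [|/hJ[->]] := eqVneq (J k l) 0.
have [Jij|Jij] := eqVneq (J i j) 0.
  rewrite big1 // => k _; have [->|/hJ[_ ik]] := eqVneq (J i k) 0.
    by rewrite mul0r.
  rewrite mxE big1 ?mulr0 // => l _; rewrite mxE.
  have [->|/hJ[_ lk]] := eqVneq (J l k) 0; first by rewrite mul0r.
  have li : l = i by apply/val_inj/eq_add_S; rewrite -ik -lk.
  by rewrite li Jij mulr0.
have [Jij1 ij] := hJ _ _ Jij.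
rewrite (bigD1 j) //= big1 => [|k kj]; last first.
  have [->|/hJ[_ ik]] := eqVneq (J i k) 0; first by rewrite mul0r.
  by case/negP: kj; apply/eqP/val_inj; rewrite /= ij ik.
rewrite addr0 mxE (bigD1 i) //= big1 => [|l li]; last first.
  rewrite mxE; have [->|/hJ[_ lj]] := eqVneq (J l j) 0; first by rewrite mul0r.
  by case/negP: li; apply/eqP/val_inj/eq_add_S; rewrite -lj -ij.
by rewrite mxE Jij1 addr0 !mulr1.
Qed.

(** [J] has offset 1 and its transpose offset -1, so the products required to commute are
    diagonal. *)
Lemma truncated_shift_matrix J p :
  shift_matrix J -> J ^+ p = 0 -> truncated_shift J J^T p.
Proof.
move=> hJ Jp; have JTJ := shift_matrix_partial_isometry hJ.
have dJ : on_diagonal J 1 0 by move=> i j /hJ[_ ->]; rewrite addn0 addn1.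
have dJT : on_diagonal J^T 0 1.
  by move=> i j; rewrite mxE => /dJ.
split=> //.
(* The second relation is the transpose of the first. *)
- rewrite -[X in _ = X](congr1 trmx JTJ).
  by rewrite -[J * J^T * J]/(J *m J^T *m J) !trmx_mul trmxK mulmxA.
- move=> i; apply: on_diagonal_comm (on_diagonalM dJ dJT) _.
  by have := on_diagonalM (on_diagonalX (i := i) dJT) (on_diagonalX (i := i) dJ);
    rewrite addnC; apply.
- move=> i; apply: on_diagonal_comm (on_diagonalM dJT dJ) _.
  by have := on_diagonalM (on_diagonalX (i := i) dJ) (on_diagonalX (i := i) dJT);
    rewrite addnC; apply.
- by rewrite Jp mul0r.
- by rewrite Jp mulr0.
Qed.

End ShiftMatrix.

(** * Invariance under conjugation *)

Section Conjugation.
Context (K : comUnitRingType) (n : nat) (P : 'M[K]_n) (Pu : P \in unitmx).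
Implicit Types (A B : 'M[K]_n).

Let conj A : 'M[K]_n := invmx P *m A *m P.

Lemma conjmxM A B : conj A * conj B = conj (A * B).
Proof. by rewrite /conj -[LHS]/(_ *m _) !mulmxA mulmxK // -[A * B]/(A *m B) !mulmxA. Qed.

Lemma conjmxX A i : conj A ^+ i = conj (A ^+ i).
Proof.
elim: i => [|i IHi]; last by rewrite !exprS IHi conjmxM.
by rewrite !expr0 /conj mulmx1 mulVmx.
Qed.

Lemma conjmx_eq0 A : conj A = 0 -> A = 0.
Proof.
move=> /(congr1 (fun B => P *m B *m invmx P)).
by rewrite /conj !mulmxA mulmxV // mul1mx mulmxK // mulmx0 mul0mx.
Qed.

Lemma truncated_shift_conj A B p :
  truncated_shift A B p -> truncated_shift (conj A) (conj B) p.
Proof.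
case=> aba bab ab ba zab zba.
by split=> [||i|i||]; rewrite /GRing.comm ?conjmxX !conjmxM ?aba ?bab ?ab ?ba
  ?zab ?zba // /conj mulmx0 mul0mx.
Qed.

End Conjugation.

(** * Nilpotent Jordan matrices are shift matrices *)

Section NilpotentJordan.
Context (K : fieldType).

Lemma jordan_form_offdiag n (J : 'M[K]_n) (i j : 'I_n) :
  jordan_form J -> i != j -> J i j != 0 -> J i j = 1 /\ j = i.+1 :> nat.
Proof.
case=> b [s [a [e [_ ->]]]]; case: _ / e i j => i j.
rewrite castmx_id mxE.
(* Each index becomes a pair: its block and its position there. *)
move: (tagnat.sig1 i) (tagnat.sig2 i) (tagnat.sig1 j) (tagnat.sig2 j)
  (tagnat.sig2K i) (tagnat.sig2K j) => k u l v <- <- {i j}.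
case: (eqVneq k l) v => [<- v|_ v _]; last by rewrite mxE eqxx.
rewrite conform_mx_id mxE.
have [->|_ _] := eqVneq u v; first by rewrite eqxx.
have [uv _|_] := @eqP _ u.+1 v; last by rewrite eqxx.
by rewrite !tagnat.RankEsum -uv addnS.
Qed.

(** In row i of J J^p only k = i contributes: J i k vanishes for k < i, and by induction (J^p) k j
    vanishes for k > i, as j <= i. *)
Lemma upper_triangularX n (J : 'M[K]_n) p (i j : 'I_n) :
    (forall k l : 'I_n, (l < k)%N -> J k l = 0) -> (j <= i)%N ->
  (J ^+ p) i j = (i == j)%:R * J i i ^+ p.
Proof.
move=> tJ; elim: p i j => [|p IHp] i j ji; first by rewrite mxE mulr1.
rewrite exprS mxE (bigD1 i) //= IHp // big1 ?addr0 => [|k ki].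
  by rewrite mulrCA exprS.
have [lti|gti|/val_inj ik] := ltngtP k i; first by rewrite tJ // mul0r.
  have ltj := leq_ltn_trans ji gti; rewrite (IHp _ _ (ltnW ltj)).
  by rewrite -val_eqE /= gtn_eqF // mul0r mulr0.
by rewrite ik eqxx in ki.
Qed.

(** The diagonal of J^p consists of the powers (J i i)^p, so nilpotency over a field makes every
    eigenvalue 0. *)
Lemma nilpotent_jordan_shift n (J : 'M[K]_n) p :
  jordan_form J -> J ^+ p = 0 -> shift_matrix J.
Proof.
move=> jJ Jp i j; have [<- {j}|ij] := eqVneq i j; last exact: jordan_form_offdiag.
have tJ : forall j k : 'I_n, (k < j)%N -> J j k = 0.
  move=> j k kj; apply/eqP; apply: contraTT (kj) => Jjk.
  have jk : j != k by apply: contraTneq kj => ->; rewrite ltnn.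
  by have [_ ->] := jordan_form_offdiag jJ jk Jjk; rewrite -leqNgt.
have := upper_triangularX p tJ (leqnn i).
rewrite Jp mxE eqxx mul1r => /esym/eqP.
by rewrite expf_eq0 => /andP[_ ->].
Qed.

End NilpotentJordan.

Theorem corollary4p4 (R : realType) (n : nat) (N M : 'M[R]_n) (p : nat)
    (hp : nilpotency_index N p) (hp2 : (2 <= p)%N)
    (hM : conjugate_transpose N M) :
  [/\ commutator (mbar_star N M p) (nbar_star N) = hbar_star N M p,
      commutator (hbar_star N M p) (nbar_star N) = - (nbar_star N *+ 2) &
      commutator (hbar_star N M p) (mbar_star N M p) = mbar_star N M p *+ 2].
Proof.
have [J [P [jJ Pu NE ME]]] := hM.
have Jp : J ^+ p = 0.
  by apply: (conjmx_eq0 Pu); rewrite -conjmxX // -NE; case: hp.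
have NM : truncated_shift N M p.
  rewrite NE ME; apply: truncated_shift_conj => //.
  by apply: truncated_shift_matrix => //; apply: nilpotent_jordan_shift jJ Jp.
have xy := truncated_shift_star NM.
(* The operators of the theorem are [sl2_m] and [sl2_h] at the starred matrices, by conversion. *)
by split; [apply: commutator_mn | apply: (has_weight_hn xy) |
  apply: (has_weight_hm xy)].
Qed.
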